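(* Let $A$ be a power-associative algebra over a field $F$ which is algebraic (every element of $A$ satisfies a nonzero polynomial equation over $F$) and has no zero divisors. If $R$ is a Rota–Baxter operator of weight zero on $A$, then $R=0$.
   Context: An algebra is a vector space with a bilinear product, not necessarily associative. A linear operator $R\colon A\to A$ is a Rota–Baxter operator (RB-operator) of weight $\lambda\in F$ if $R(x)R(y)=R(R(x)y+xR(y)+\lambda xy)$ for all $x,y\in A$. An algebra is power-associative if every single element generates an associative subalgebra. *)

(* Defs.v *)
From HB Require Import structures.
From mathcomp Require Import all_boot all_order all_algebra.
Set Implicit Arguments. Unset Strict Implicit. Unset Printing Implicit Defensive.
Import GRing.Theory.
Local Open Scope ring_scope.

Definition bilinear_prod (F : fieldType) (A : lmodType F) (m : A -> A -> A) :=
  (forall (a : F) (x y z : A), m (a *: x + y) z = a *: m x z + m y z) /\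
  (forall (a : F) (x y z : A), m z (a *: x + y) = a *: m z x + m z y).

Inductive gen_subalg (F : fieldType) (A : lmodType F) (m : A -> A -> A) (x : A)
  : A -> Prop :=
  | gen_base : gen_subalg m x x
  | gen_zero : gen_subalg m x 0
  | gen_lin : forall (a : F) u v, gen_subalg m x u -> gen_subalg m x v ->
      gen_subalg m x (a *: u + v)
  | gen_mul : forall u v, gen_subalg m x u -> gen_subalg m x v ->
      gen_subalg m x (m u v).

Definition power_associative (F : fieldType) (A : lmodType F) (m : A -> A -> A) :=
  forall x u v w : A, gen_subalg m x u -> gen_subalg m x v -> gen_subalg m x w ->
    m (m u v) w = m u (m v w).

(* npow m x n = x^(n+1), left-normed powers. *)
Fixpoint npow (A : Type) (m : A -> A -> A) (x : A) (n : nat) : A :=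
  match n with
  | O => x
  | S k => m (npow m x k) x
  end.

(* Algebraic: every element is a root of a nonzero polynomial over F
   (without constant term, since A need not be unital):
   p(x) = sum_{i >= 1} p_i x^i = 0. *)
Definition algebraic_alg (F : fieldType) (A : lmodType F) (m : A -> A -> A) :=
  forall x : A, exists p : {poly F},
    [/\ p != 0, p`_0 = 0 &
        \sum_(1 <= i < size p) p`_i *: npow m x i.-1 = 0].

Definition no_zero_divisors (F : fieldType) (A : lmodType F) (m : A -> A -> A) :=
  forall x y : A, m x y = 0 -> x = 0 \/ y = 0.

Definition rota_baxter (F : fieldType) (A : lmodType F) (m : A -> A -> A)
  (lambda : F) (R : A -> A) :=
  (forall (a : F) (x y : A), R (a *: x + y) = a *: R x + R y) /\
  (forall x y : A, m (R x) (R y) = R (m (R x) y + m x (R y) + lambda *: m x y)).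

(* Main.v *)
Require Import Defs.
From HB Require Import structures.
From mathcomp Require Import all_boot all_order all_algebra ring.
Set Implicit Arguments.
Unset Strict Implicit.
Unset Printing Implicit Defensive.
Import GRing.Theory.
Local Open Scope ring_scope.

(** A nonzero element of the image of [R] generates a field inside that image,
    so some nonzero idempotent is [e = R z].  Put [T x = e x + x e] and
    [S = T - 1].  Since [e = e e = R (T z)], [R] kills [S z], and its kernel is
    stable under [T] and [S]; hence [R (T^k z) = e] and [R] kills
    [S^(j+1) T^k z].  On the other hand [S] is injective because there are no
    zero divisors.  So it suffices that the [S]-orbit of some [T^k z] be
    eventually periodic: it is then periodic, and [e = R (T^k z) = 0].

    If [2 <> 0], third and fourth power associativity, polarized at [e + y] and
    [e - y] so that no assumption on the number of scalars is needed, give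
    [S^4 = S^2].

    If [2 = 0], the commutator is a Lie bracket, [T = ad e], and the defect
    [(x, y) |-> [x^2, y] - [x, [x, y]]] of squaring, linear in [y], turns out to
    be symmetric.  It is quadratic in [x], so a scalar other than [0] and [1]
    forces it to vanish, whence [S^2 = S].  Over the field with two elements it
    need not vanish, but its bilinearity still gives
    [T^2 (y^(2^n)) = S^n T^2 y] for [y = T^2 z], and [y] has only finitely many
    powers. *)

Lemma inj_looping_periodic (X : eqType) (f : X -> X) x n :
  injective f -> looping f x n -> exists k, x = iter k.+1 f x.
Proof.
move=> f_inj /trajectP [i]; elim: i n => [|i IHi] [|n] //=; first by exists n.
by rewrite ltnS => lt_in /f_inj; apply: IHi.
Qed.

(** * Linear identities *)

Definition triv_ext (K : comNzRingType) (V : lmodType K) : Type := (K * V)%type.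

Section TrivialExtension.
Variables (K : comNzRingType) (V : lmodType K).
Implicit Types x y : triv_ext V.

HB.instance Definition _ := GRing.Zmodule.copy (triv_ext V) (K * V)%type.

Definition triv_ext_mul x y : triv_ext V :=
  (x.1 * y.1, x.1 *: y.2 + y.1 *: x.2).

Fact triv_ext_mulA : associative triv_ext_mul.
Proof.
move=> [a u] [b v] [c w]; congr pair; rewrite /= ?mulrA //.
by rewrite !scalerDr !scalerA addrA [c * a]mulrC [c * b]mulrC.
Qed.

Fact triv_ext_mulC : commutative triv_ext_mul.
Proof. by move=> [a u] [b v]; rewrite /triv_ext_mul mulrC addrC. Qed.

Fact triv_ext_mul1 : left_id ((1, 0) : triv_ext V) triv_ext_mul.
Proof. by move=> [a u]; rewrite /triv_ext_mul mul1r scale1r scaler0 addr0. Qed.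

Fact triv_ext_mulDl : left_distributive triv_ext_mul +%R.
Proof.
move=> [a u] [b v] [c w]; congr pair; rewrite /= ?mulrDl //.
by rewrite scalerDl scalerDr addrACA.
Qed.

Fact triv_ext_oner_neq0 : ((1, 0) : triv_ext V) != 0.
Proof. by rewrite xpair_eqE oner_eq0. Qed.

HB.instance Definition _ := GRing.Zmodule_isComNzRing.Build (triv_ext V)
  triv_ext_mulA triv_ext_mulC triv_ext_mul1 triv_ext_mulDl triv_ext_oner_neq0.

Definition to_triv_ext (v : V) : triv_ext V := (0, v).

Fact to_triv_ext_is_zmod_morphism : zmod_morphism to_triv_ext.
Proof. by move=> u v; congr pair; rewrite subr0. Qed.

HB.instance Definition _ :=
  GRing.isZmodMorphism.Build V (triv_ext V) to_triv_ext
    to_triv_ext_is_zmod_morphism.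

Lemma to_triv_ext_inj : injective to_triv_ext.
Proof. by move=> u v []. Qed.

End TrivialExtension.

(* A module embeds in its trivial extension, a commutative ring, where [ring]
   decides identities between signed sums of elements of the module. *)
Ltac lmod_ring := apply: to_triv_ext_inj; ring.

Lemma eq_from_sub (V : zmodType) (a b u v : V) :
  a = b -> u - v = a - b -> u = v.
Proof. by move=> -> /eqP; rewrite subrr subr_eq0 => /eqP. Qed.

Lemma eq_from_sub2 (V : zmodType) (a b c d u v : V) :
  a = b -> c = d -> u - v = (a - c) - (b - d) -> u = v.
Proof. by move=> -> ->; apply: eq_from_sub. Qed.

Section CharacteristicTwo.
Variables (K : comNzRingType) (V : lmodType K).
Hypothesis char2 : 2 \in [pchar K].

Lemma addvv_pchar2 (v : V) : v + v = 0.
Proof. by rewrite -mulr2n -scaler_nat (pcharf0 char2) scale0r. Qed.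

Lemma oppv_pchar2 (v : V) : - v = v.
Proof. by apply/eqP; rewrite eq_sym -addr_eq0 addvv_pchar2. Qed.

Lemma eq_from_add_pchar2 (u v : V) : u + v = 0 -> u = v.
Proof. by move=> /eqP; rewrite addr_eq0 oppv_pchar2 => /eqP. Qed.

Lemma even_natr_triv_ext (n : nat) : ~~ odd n -> n%:R = 0 :> triv_ext V.
Proof.
move=> n_even; rewrite -(even_halfK n_even) -muln2 natrM.
rewrite [2%:R](_ : _ = 0) ?mulr0 //.
by congr pair; [exact: (pcharf0 char2) | exact: addr0].
Qed.

End CharacteristicTwo.

(* [ring] reduces a coefficient only by a hypothesis on that very coefficient;
   once all the terms stand on the same side, only 2 and 4 occur below. *)
Ltac lmod_ring2 char2 :=
  apply: (eq_from_add_pchar2 char2); rewrite ?(oppv_pchar2 char2);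
  apply: to_triv_ext_inj;
  lazymatch goal with |- @eq (@triv_ext _ ?V) _ _ =>
    ring: (even_natr_triv_ext V char2 (isT : ~~ odd 2))
          (even_natr_triv_ext V char2 (isT : ~~ odd 4))
  end.

(** * Squaring in characteristic two *)

Section QuadraticSquaring.
Variables (K : fieldType) (V : lmodType K).
Variables (br : {bilinear V -> V -> V}) (s : V -> V).
Hypothesis char2 : 2 \in [pchar K].
Hypothesis sZ : forall a x, s (a *: x) = a ^+ 2 *: s x.
Hypothesis sD : forall x y, s (x + y) = s x + s y + br x y.
Hypothesis brsx : forall x, br (s x) x = 0.

Lemma polar_sym x y : br x y = br y x.
Proof.
apply: (addrI (s x + s y)).
by rewrite -sD addrC sD [s x + s y]addrC.
Qed.

Lemma polar_alt x : br x x = 0.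
Proof.
have := sD x x; rewrite !(addvv_pchar2 char2) add0r => <-.
by rewrite -[in s _](scale0r 0) sZ expr0n scale0r.
Qed.

(* [br] is a Lie bracket, and the defect of [s] from making it a restricted Lie
   algebra, where [ad (s x) = (ad x)^2]. *)
Definition sq_defect x y := br (s x) y + br x (br x y).

Lemma sq_defectDr x y z : sq_defect x (y + z) = sq_defect x y + sq_defect x z.
Proof. by rewrite /sq_defect !linearDr addrACA. Qed.

Lemma sq_defectC x y : sq_defect x y = sq_defect y x.
Proof.
apply: eq_from_sub (brsx (x + y)) _.
rewrite sD !linearDl !linearDr !brsx /sq_defect.
rewrite (polar_sym (br x y) x) (polar_sym (br x y) y) (polar_sym y x).
lmod_ring2 char2.
Qed.

Lemma sq_defectDl x y z : sq_defect (x + y) z = sq_defect x z + sq_defect y z.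
Proof. by rewrite sq_defectC sq_defectDr !(sq_defectC z). Qed.

Lemma sq_defectxx x : sq_defect x x = 0.
Proof. by rewrite /sq_defect brsx polar_alt linear0r addr0. Qed.

Lemma sq_defect_eq0 (a : K) x y : a != 0 -> a != 1 -> sq_defect x y = 0.
Proof.
move=> a_neq0 a_neq1; apply/eqP; suff: (a * (1 - a)) *: sq_defect x y == 0.
  rewrite scaler_eq0 mulf_eq0 subr_eq0 [1 == _]eq_sym.
  by rewrite (negPf a_neq0) (negPf a_neq1).
have defectZr u v : sq_defect u (a *: v) = a *: sq_defect u v.
  by rewrite /sq_defect !linearZr_LR scalerDr.
have defectZl u v : sq_defect (a *: u) v = a ^+ 2 *: sq_defect u v.
  by rewrite /sq_defect sZ !linearZl_LR linearZr_LR scalerA scalerDr.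
by rewrite mulrBr mulr1 scalerBl -defectZr sq_defectC defectZl sq_defectC subrr.
Qed.

Lemma polar_jacobi x y z : br x (br y z) = br (br x y) z + br y (br x z).
Proof.
apply: eq_from_sub (sq_defectDl x y z) _.
by rewrite /sq_defect sD !linearDl !linearDr; lmod_ring2 char2.
Qed.

Lemma sq_defect_der x y z :
  sq_defect x (br y z) = br (sq_defect x y) z + br y (sq_defect x z).
Proof.
rewrite /sq_defect !linearDl !linearDr (polar_jacobi (s x)).
rewrite (polar_jacobi x y z) linearDr (polar_jacobi x (br x y)).
rewrite (polar_jacobi x y (br x z)).
lmod_ring2 char2.
Qed.

Let second_defect x y := sq_defect (s x) y + br x (sq_defect x y).

Let second_defectDl x y z :
  second_defect (x + y) z = second_defect x z + second_defect y z.
Proof.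
rewrite /second_defect sD !sq_defectDl linearDl.
rewrite !(linearDr br _ (sq_defect _ _)) (sq_defectC (br x y)) sq_defect_der.
rewrite (polar_sym (sq_defect z x)) (sq_defectC z x) (sq_defectC z y).
lmod_ring2 char2.
Qed.

Let second_defect_der x y z : second_defect x (br y z) =
  br (second_defect x y) z + br y (second_defect x z)
  + (br (br x y) (sq_defect x z) + br (sq_defect x y) (br x z)).
Proof.
rewrite /second_defect !sq_defect_der (linearDr br x (br _ z)).
rewrite !(linearDl br _ (sq_defect _ _)) !(linearDr br _ (sq_defect _ _)).
rewrite (polar_jacobi x (sq_defect x y) z) (polar_jacobi x y (sq_defect x z)).
lmod_ring2 char2.
Qed.

(* [second_defect] is additive in its first variable, hence so is its failure
   to be a derivation, which is visibly quadratic: the polarization vanishes. *)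
Lemma br_sq_defect x y z :
  br (br x y) (sq_defect y z) = br (sq_defect x y) (br y z).
Proof.
have := second_defectDl x y (br y z).
rewrite !second_defect_der !second_defectDl !sq_defectDl.
rewrite sq_defectxx !(linearDl br _ x y) polar_alt !linear0l !addr0.
move=> additivity; apply: eq_from_sub additivity _.
rewrite (linearDl br _ (second_defect x y)) (linearDr br _ (second_defect x z)).
rewrite (linearDr br _ (sq_defect x z)) (linearDr br _ (br x z)).
lmod_ring2 char2.
Qed.

Variable e : V.
Hypothesis se : s e = e.
Local Notation T := (br e).
Let S x := T x - x.

Lemma polar_idem_sub_idem (a : K) x : a != 0 -> a != 1 -> S (S x) = S x.
Proof.
move=> a_neq0 a_neq1.
apply: eq_from_sub (sq_defect_eq0 e x a_neq0 a_neq1) _.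
by rewrite /sq_defect /S se linearB; lmod_ring2 char2.
Qed.

Lemma polar_idem_sq x : T (s x) = br (T x) x + T x + T (T x).
Proof.
apply: eq_from_sub (sq_defectC e x) _.
rewrite /sq_defect se (polar_sym (s x)) (polar_sym x e) (polar_sym (T x) x).
lmod_ring2 char2.
Qed.

Lemma polar_idem_adj x y : br (T x) (T (T y)) = br (T (T x)) (T y).
Proof.
apply: eq_from_sub (br_sq_defect x e y) _.
rewrite (sq_defectC x) /sq_defect se (polar_sym x e) linearDl linearDr.
lmod_ring2 char2.
Qed.

Lemma polar_idem_br x y : T (br (T x) (T y)) = 0.
Proof. by rewrite polar_jacobi polar_idem_adj (addvv_pchar2 char2). Qed.

Let T_iterS n x : T (iter n S x) = iter n S (T x).
Proof. by elim: n => // n IHn; rewrite !iterS {1}/S linearBr IHn. Qed.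

Let br_ad3_eq0 q t : T (T q) = 0 -> T (br q (T (T t))) = 0 ->
  br q (T (T (T t))) = 0.
Proof.
by move=> TTq; rewrite polar_jacobi polar_idem_adj TTq linear0l add0r.
Qed.

(* [T^2] kills [q = x + T^2 S^n z], so by [br_ad3_eq0] [q] commutes with
   [T^3 z], then with [T^4 z], then with every [S^k T^4 z]. *)
Lemma polar_idem_comm z n x : br x (T (T z)) = 0 ->
  T (T x) = iter n S (T (T (T (T z)))) -> br (T (T x)) x = 0.
Proof.
set y := T (T z) => xy TTx; set t := iter n S z.
have TTt : T (T t) = iter n S y by rewrite !T_iterS.
pose q := x + T (T t).
have TTq : T (T q) = 0.
  by rewrite !linearDr TTx TTt !T_iterS (addvv_pchar2 char2).
have qTy : br q (T y) = 0.
  by apply: br_ad3_eq0 => //; rewrite linearDl xy add0r polar_idem_br.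
have qTTy k : br q (iter k S (T (T y))) = 0.
  elim: k => [|k IHk].
    by apply: (@br_ad3_eq0 q (T z)) => //; rewrite qTy linear0.
  rewrite iterS {1}/S linearBr IHk subr0 -!T_iterS.
  by apply: br_ad3_eq0 => //; rewrite !T_iterS IHk linear0.
have {1}-> : T (T x) = T (T (T (T t))) by rewrite TTx TTt !T_iterS.
have -> : x = q + T (T t) by rewrite /q -addrA (addvv_pchar2 char2) addr0.
have qTTTTt : br q (T (T (T (T t)))) = 0 by rewrite !T_iterS qTTy.
by rewrite linearDr (polar_sym _ q) qTTTTt add0r -polar_idem_adj polar_alt.
Qed.

Lemma polar_idem_iter_sq z n :
  (forall k, br (iter k s (T (T z))) (T (T z)) = 0) ->
  T (T (iter n s (T (T z)))) = iter n S (T (T (T (T z)))).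
Proof.
move=> comm; elim: n => //= n IHn.
rewrite polar_idem_sq !linearDr polar_jacobi polar_alt addr0.
rewrite (polar_idem_comm (comm n) IHn) add0r -IHn /S; lmod_ring2 char2.
Qed.

End QuadraticSquaring.

(** * The operator [x |-> e x + x e - x] *)

Section Jordan.
Variables (F : fieldType) (A : lmodType F) (m : {bilinear A -> A -> A}).

Definition jordan x y := m x y + m y x.

Fact jordan_is_bilinear :
  bilinear_for (GRing.Scale.Law.clone _ _ *:%R _)
               (GRing.Scale.Law.clone _ _ *:%R _) jordan.
Proof.
by split=> [z|z] a x y; rewrite /jordan linearPl linearPr addrACA -scalerDr.
Qed.

HB.instance Definition _ :=
  bilinear_isBilinear.Build F A A A _ _ jordan jordan_is_bilinear.

Lemma jordanC x y : jordan x y = jordan y x.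
Proof. exact: addrC. Qed.

Lemma sqrvD x y : m (x + y) (x + y) = m x x + jordan x y + m y y.
Proof. by rewrite linearDl !linearDr /jordan !addrA. Qed.

Lemma sqrvB x y : m (x - y) (x - y) = m x x - jordan x y + m y y.
Proof. by rewrite sqrvD linearNr linearNl linearNr opprK. Qed.

(* When 2 is invertible and [e] is idempotent, the kernel of [peirce_half e] is
   the Peirce 1/2-space of [e]. *)
Definition peirce_half e x := jordan e x - x.

Fact peirce_half_is_linear e : linear (peirce_half e).
Proof.
by move=> a x y; rewrite /peirce_half linearPr scalerBr opprD addrACA.
Qed.

HB.instance Definition _ e :=
  GRing.isLinear.Build F A A *:%R (peirce_half e) (peirce_half_is_linear e).

Lemma jordanE e x : jordan e x = x + peirce_half e x.
Proof. by rewrite addrC subrK. Qed.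

(* The part of [v^2 v^2 - v^3 v] at [v = x + y] that is linear in [y]. *)
Definition quartic_polar x y :=
  jordan (m x x) (jordan x y)
  - m (m (jordan x y) x + m (m x x) y) x - m (m (m x x) x) y.

Fact quartic_polar_is_zmod_morphism x : zmod_morphism (quartic_polar x).
Proof.
move=> y z; rewrite /quartic_polar !(linearBr, linearBl, linearDl); lmod_ring.
Qed.

HB.instance Definition _ x := GRing.isZmodMorphism.Build A A (quartic_polar x)
  (quartic_polar_is_zmod_morphism x).

End Jordan.

(** * One-generated subalgebras *)

Section Evaluation.
Variables (F : fieldType) (A : lmodType F) (m : A -> A -> A).
Implicit Types (x : A) (p q : {poly F}).

(* [evalMX x p] is the value at [x] of [p * 'X]: [A] need not have a unit,
   so only polynomials without constant term can be evaluated. *)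
Definition evalMX x p := \sum_(i < size p) p`_i *: npow m x i.

Lemma evalMX_widen x p n : (size p <= n)%N ->
  evalMX x p = \sum_(i < n) p`_i *: npow m x i.
Proof.
move=> le_pn.
rewrite /evalMX (big_ord_widen n (fun i => p`_i *: npow m x i)) // big_mkcond.
apply: eq_bigr => i _.
by case: ltnP => // le_pi; rewrite nth_default // scale0r.
Qed.

Fact evalMX_is_linear x : linear (evalMX x).
Proof.
move=> a p q; set n := maxn (size p) (size q).
have le_n : (size (a *: p + q)%R <= n)%N.
  apply: leq_trans (size_polyD _ _) _; rewrite geq_max leq_maxr andbT.
  exact: leq_trans (size_scale_leq a p) (leq_maxl _ _).
rewrite (evalMX_widen _ le_n) (evalMX_widen _ (leq_maxl _ (size q))).
rewrite (evalMX_widen _ (leq_maxr (size p) _)) scaler_sumr -big_split /=.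
by apply: eq_bigr => i _; rewrite coefD coefZ scalerDl scalerA.
Qed.

HB.instance Definition _ x :=
  GRing.isLinear.Build F {poly F} A *:%R (evalMX x) (evalMX_is_linear x).

Lemma evalMXC x c : evalMX x c%:P = c *: x.
Proof.
rewrite (evalMX_widen _ (size_polyC_leq1 c)) big_ord_recl big_ord0 addr0.
by rewrite coefC.
Qed.

Lemma evalMX1 x : evalMX x 1 = x.
Proof. by rewrite evalMXC scale1r. Qed.

End Evaluation.

Section PowerAssociative.
Variables (F : fieldType) (A : lmodType F) (m : {bilinear A -> A -> A}).
Hypothesis m_pa : power_associative m.
Implicit Types (e x y z : A) (p q r : {poly F}).
Local Notation evalMX := (evalMX m).
Local Notation jordan := (jordan m).
Local Notation peirce_half := (peirce_half m).

Lemma evalMXMX x p : evalMX x (p * 'X) = m (evalMX x p) x.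
Proof.
have [->|p0] := eqVneq p 0; first by rewrite mul0r !linear0 linear0l.
rewrite /evalMX size_mulX // big_ord_recl coefMX scale0r add0r.
by rewrite linear_sumlz; apply: eq_bigr => i _; rewrite coefMX linearZl_LR.
Qed.

Lemma evalMXX x : evalMX x 'X = m x x.
Proof. by rewrite -['X]mul1r evalMXMX evalMX1. Qed.

Lemma evalMX_horner x p c :
  evalMX x (p * 'X + c%:P) = m (evalMX x p) x + c *: x.
Proof. by rewrite linearD /= evalMXMX evalMXC. Qed.

Lemma evalMX_gen x p : gen_subalg m x (evalMX x p).
Proof.
elim/poly_ind: p => [|p c IHp]; first by rewrite linear0; apply: gen_zero.
rewrite evalMX_horner addrC; apply: gen_lin; first exact: gen_base.
by apply: gen_mul => //; apply: gen_base.
Qed.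

Lemma mul_evalMX x p q : m (evalMX x p) (evalMX x q) = evalMX x (p * q * 'X).
Proof.
elim/poly_ind: q => [|q c IHq]; first by rewrite mulr0 mul0r !linear0.
rewrite evalMX_horner linearDr linearZr_LR /=.
rewrite -(m_pa (x := x)) ?IHq; try exact: evalMX_gen; last exact: gen_base.
rewrite -!evalMXMX -linearZ -linearD -mul_polyC; congr (evalMX x _); ring.
Qed.

Lemma evalMX_comm x p q :
  m (evalMX x p) (evalMX x q) = m (evalMX x q) (evalMX x p).
Proof. by rewrite !mul_evalMX (mulrC p). Qed.

Lemma evalMX_mulr_eq0 x p q : evalMX x p = 0 -> evalMX x (p * q) = 0.
Proof.
move=> px0; elim/poly_ind: q => [|q c IHq]; first by rewrite mulr0 linear0.
rewrite mulrDr mulrA linearD /= evalMXMX IHq linear0l add0r.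
by rewrite mulrC mul_polyC linearZ /= px0 scaler0.
Qed.

Lemma evalMX_modp x p q : evalMX x p = 0 -> evalMX x (q %% p) = evalMX x q.
Proof.
move=> px0; rewrite [in RHS](divp_eq q p) linearD /= mulrC evalMX_mulr_eq0 //.
by rewrite add0r.
Qed.

Lemma sqrv_comm x : m (m x x) x = m x (m x x).
Proof. by rewrite -[x](evalMX1 m) !mul_evalMX; congr (evalMX x _); ring. Qed.

(** * Orbits of the operator [peirce_half e] *)

Section CharacteristicNotTwo.
Hypothesis char_neq2 : (2 : F) != 0.

Let addvv_eq0 (v : A) : v + v = 0 -> v = 0.
Proof.
move=> /eqP; rewrite -mulr2n -scaler_nat scaler_eq0 (negPf char_neq2).
by move=> /eqP.
Qed.

Lemma peirce_half_comm e y :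
  m e e = e -> m e (peirce_half e y) = m (peirce_half e y) e.
Proof.
move=> ee; apply/eqP; rewrite -subr_eq0; apply/eqP/addvv_eq0.
have := sqrv_comm (e + y); have := sqrv_comm (e - y).
rewrite sqrvB sqrvD ee /peirce_half; move: (jordan e y) => j.
rewrite !(linearDl m, linearDr m, linearNl m, linearNr m) sqrv_comm.
move=> sub_eq add_eq.
apply: eq_from_sub2 sub_eq add_eq _; lmod_ring.
Qed.

Let quartic_polarDr x : {morph quartic_polar m x : y z / y + z} := raddfD _.
Let quartic_polarNr x : {morph quartic_polar m x : y / - y} := raddfN _.

(* Subtracting the quartic identity at [x - y] from the one at [x + y] leaves
   the terms of odd degree in [y], of degree 1 or 3. *)
Lemma quartic_polar_anti x y : quartic_polar m x y = - quartic_polar m y x.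
Proof.
have quartic v : m (m v v) (m v v) = m (m (m v v) v) v.
  by rewrite -[v](evalMX1 m) !mul_evalMX; congr (evalMX v _); ring.
apply/eqP; rewrite -addr_eq0; apply/eqP/addvv_eq0.
have := quartic (x + y); have := quartic (x - y).
rewrite sqrvB (sqrvD m x y) /quartic_polar (jordanC m y x).
move: (jordan x y) => j; rewrite /jordan.
rewrite !(linearDl m, linearDr m, linearNl m, linearNr m) !quartic.
move=> sub_eq add_eq.
apply: eq_from_sub2 add_eq sub_eq _; lmod_ring.
Qed.

Let quartic_polarDl x y v :
  quartic_polar m (x + y) v = quartic_polar m x v + quartic_polar m y v.
Proof.
by rewrite quartic_polar_anti quartic_polarDr opprD -!(quartic_polar_anti _ v).
Qed.

Let quartic_polarNl x v : quartic_polar m (- x) v = - quartic_polar m x v.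
Proof.
by rewrite quartic_polar_anti quartic_polarNr -(quartic_polar_anti x).
Qed.

Lemma quartic_polarxx x : quartic_polar m x x = 0.
Proof. by apply: addvv_eq0; rewrite {1}quartic_polar_anti addNr. Qed.

Lemma quartic_polar_sqr x : quartic_polar m x (m x x) = 0.
Proof.
rewrite /quartic_polar /jordan -[x](evalMX1 m).
rewrite !(mul_evalMX, =^~ linearD, =^~ linearB) /=.
rewrite [X in evalMX x X](_ : _ = 0) ?linear0 //; ring.
Qed.

Lemma quartic_polar_idem e y :
  m e e = e -> quartic_polar m e (peirce_half e y) = 0.
Proof.
move=> ee; apply: addvv_eq0.
have := quartic_polar_sqr (e + y); have := quartic_polar_sqr (e - y).
rewrite sqrvB sqrvD ee /peirce_half; move: (jordan e y) => j.
rewrite !(quartic_polarDl, quartic_polarDr, quartic_polarNl, quartic_polarNr).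
rewrite !quartic_polarxx !quartic_polar_sqr (quartic_polar_anti y e).
move=> sub_eq add_eq.
apply: eq_from_sub2 add_eq sub_eq _; lmod_ring.
Qed.

(* [e] commutes with [S^j z] for [j > 0], so [2 (S^j z) e = S^j z + S^(j+1) z]:
   this turns the quartic identity into a relation between the [S^j z]. *)
Lemma peirce_half_looping_neq2 e z : m e e = e -> looping (peirce_half e) z 4.
Proof.
move=> ee; apply/trajectP; exists 2 => //=.
set x := peirce_half e z; set x1 := peirce_half e x; set x2 := peirce_half e x1.
have ex : m e x = m x e by apply: peirce_half_comm.
have double u : m e u = m u e -> m u e + m u e = u + peirce_half e u.
  by move=> eu; rewrite -jordanE /jordan eu.
have x_e : m x e + m x e = x + x1 := double x ex.
have x1_e : m x1 e + m x1 e = x1 + x2 by apply: double; apply: peirce_half_comm.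
have x1_fix : m (m x1 e) e = m x1 e.
  have := quartic_polar_idem z ee; rewrite /quartic_polar !ee ex -/x.
  rewrite !(jordanE m e) -/x1 (linearD (peirce_half e)) /= -/x1 -/x2.
  rewrite (linearDl m e x x1) [m x e + _ + _]addrAC x_e.
  rewrite (linearDl m e (x + x1)) (linearDl m e x x1) -x_e -x1_e => B0.
  by apply: eq_from_sub (esym B0) _; lmod_ring.
have x12_fix : m (x1 + x2) e = x1 + x2.
  by rewrite -x1_e (linearDl m e (m x1 e)) x1_fix.
have x2_e : m x2 e + m x2 e = x2 + peirce_half e x2.
  by apply: double; apply: peirce_half_comm.
have := congr2 +%R x12_fix x12_fix.
rewrite (linearDl m e x1) addrACA x1_e x2_e => x12_eq.
by apply: eq_from_sub x12_eq _; lmod_ring.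
Qed.

End CharacteristicNotTwo.

Local Notation sqr := (fun v : A => m v v).

Lemma iter_sqr_evalMX x n : exists p, iter n sqr x = evalMX x p.
Proof.
elim: n => [|n [p IHn]]; first by exists 1; rewrite evalMX1.
by exists (p * p * 'X); rewrite -mul_evalMX -IHn.
Qed.

Section CharacteristicTwo.
Hypothesis char2 : 2 \in [pchar F].

Let sqrvZ (a : F) x : m (a *: x) (a *: x) = a ^+ 2 *: m x x.
Proof. by rewrite linearZl_LR linearZr_LR scalerA. Qed.

Let sqrvD_pchar2 x y : m (x + y) (x + y) = m x x + m y y + jordan x y.
Proof. by rewrite sqrvD addrAC. Qed.

Let jordan_sqr x : jordan (m x x) x = 0.
Proof. by rewrite /jordan sqrv_comm; exact: (addvv_pchar2 char2). Qed.

Lemma peirce_half_looping_scalar e z (a : F) :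
  m e e = e -> a != 0 -> a != 1 -> looping (peirce_half e) z 2.
Proof.
move=> ee a_neq0 a_neq1; apply/trajectP; exists 1 => //=.
have sub_idem := polar_idem_sub_idem char2 sqrvZ sqrvD_pchar2 jordan_sqr ee.
exact: (sub_idem _ _ a_neq0 a_neq1).
Qed.

Lemma peirce_half_looping_sqr e z n : m e e = e ->
  looping sqr (jordan e (jordan e z)) n ->
  looping (peirce_half e) (iter 4 (jordan e) z) n.
Proof.
set y := jordan e (jordan e z) => ee /trajectP [i lt_in loop].
have comm k : jordan (iter k sqr y) y = 0.
  have [p ->] := iter_sqr_evalMX y k.
  have := evalMX_comm y p 1; rewrite evalMX1 /jordan => ->.
  exact: (addvv_pchar2 char2).
have iterE := polar_idem_iter_sq char2 sqrvZ sqrvD_pchar2 jordan_sqr ee _ comm.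
by apply/trajectP; exists i => //; rewrite -!iterE -/y loop.
Qed.

End CharacteristicTwo.

(** * Algebraic algebras without zero divisors *)

Section AlgebraicDomain.
Hypothesis m_alg : algebraic_alg m.
Hypothesis m_dom : no_zero_divisors m.

Lemma mulIv z : z != 0 -> injective (m^~ z).
Proof.
move=> z_neq0 x y /eqP; rewrite -subr_eq0 -linearBl => /eqP /m_dom [/eqP|z0].
  by rewrite subr_eq0 => /eqP.
by rewrite z0 eqxx in z_neq0.
Qed.

Lemma evalMX_annihilator x : exists2 p : {poly F}, p != 0 & evalMX x p = 0.
Proof.
have [p [p_neq0 p0 px]] := m_alg x.
have [q pE] : exists q, p = q * 'X.
  by apply/dvdpP; rewrite -['X]subr0 -polyC0 dvdp_XsubCl /root horner_coef0 p0.
have q_neq0 : q != 0 by apply: contraNneq p_neq0 => q0; rewrite pE q0 mul0r.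
exists q => //; move: px; rewrite pE size_mulX // big_add1 big_mkord => <-.
by apply: eq_bigr => i _; rewrite coefMX.
Qed.

Lemma evalMX_has_unit x : x != 0 ->
  exists r, forall p, m (evalMX x r) (evalMX x p) = evalMX x p.
Proof.
move=> x_neq0; have [p p_neq0 px] := evalMX_annihilator x.
elim/poly_ind: p p_neq0 px => [|p c IHp]; first by rewrite eqxx.
have [->|c_neq0] := eqVneq c 0.
  rewrite evalMX_horner scale0r !addr0 => pX_neq0 /m_dom [px|x0].
    by apply: IHp => //; apply: contraNneq pX_neq0 => ->; rewrite mul0r.
  by rewrite x0 eqxx in x_neq0.
move=> _ pcx; exists (- (c^-1)%:P * p) => q; rewrite mul_evalMX.
have cVc : c%:P * (c^-1)%:P = 1 by rewrite -polyCM divff.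
have -> : - (c^-1)%:P * p * q * 'X = q - (p * 'X + c%:P) * ((c^-1)%:P * q).
  by ring: cVc.
by rewrite linearB /= evalMX_mulr_eq0 // subr0.
Qed.

Lemma evalMX_finite (c : seq F) x : (forall a, a \in c) ->
  exists r : seq A, forall p, evalMX x p \in r.
Proof.
move=> cF; have [q q_neq0 qx] := evalMX_annihilator x.
exists (codom (fun v : 'rV[seq_sub c]_(size q) =>
  evalMX x (rVpoly (map_mx val v)))) => p.
apply/codomP; exists (\row_i SeqSub (cF (p %% q)`_i)).
rewrite -(evalMX_modp p qx); congr (evalMX x _).
have pq_small : (size (p %% q)%R <= size q)%N by rewrite ltnW // ltn_modp.
by rewrite -{1}(poly_rV_K pq_small); congr rVpoly; apply/rowP=> i; rewrite !mxE.
Qed.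

Lemma sqr_looping (c : seq F) x : (forall a, a \in c) ->
  exists n, looping sqr x n.
Proof.
move=> /evalMX_finite - /(_ x) [r rP]; exists (size r).
apply: contraT; rewrite -looping_uniq => /uniq_leq_size size_le.
have := size_le r; rewrite size_traject ltnn; apply=> _ /trajectP [i _ ->].
by have [p ->] := iter_sqr_evalMX x i.
Qed.

(* With [u = e + x] we get [x^2 = u^2 - u], so the fields generated by [x] and
   by [u] meet and have the same unit, which must then be [e]. *)
Lemma peirce_half_inj e : e != 0 -> m e e = e -> injective (peirce_half e).
Proof.
move=> e_neq0 ee; apply: raddf_inj => x /eqP; rewrite subr_eq0 => /eqP ex.
apply/eqP/contraT => x_neq0; pose u := e + x.
have u2u : m u u - u = m x x by rewrite /u sqrvD ee ex; lmod_ring.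
have xx_neq0 : m x x != 0 by apply: contraNneq x_neq0 => /m_dom [] ->.
have u_neq0 : u != 0.
  by apply: contraNneq xx_neq0 => u0; rewrite -u2u u0 linear0l subr0.
have [f fP] := evalMX_has_unit x_neq0; have [g gP] := evalMX_has_unit u_neq0.
have fx : m (evalMX x f) x = x by have := fP 1; rewrite evalMX1.
have xf : m x (evalMX x f) = x by rewrite -{1}(evalMX1 m x) evalMX_comm evalMX1.
have gu : m (evalMX u g) u = u by have := gP 1; rewrite evalMX1.
have fg : evalMX x f = evalMX u g.
  apply: (mulIv xx_neq0); transitivity (m x x).
    by have := fP 'X; rewrite evalMXX.
  by have := gP ('X - 1); rewrite linearB /= evalMXX evalMX1 u2u.
have fe : evalMX x f = e.
  apply: (mulIv e_neq0); rewrite ee; apply: (addIr x).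
  by have := gu; rewrite -fg /u linearDr fx.
move: ex; rewrite /jordan -fe fx xf => /eqP; rewrite -subr_eq0 addrK => /eqP x0.
by rewrite x0 eqxx in x_neq0.
Qed.

(** * Rota-Baxter operators *)

Section RotaBaxter.
Variable R : {linear A -> A}.
Hypothesis R_rb : rota_baxter m 0 R.

Lemma rb_mul x y : m (R x) (R y) = R (m (R x) y + m x (R y)).
Proof. by rewrite R_rb.2 scale0r addr0. Qed.

Lemma evalMX_rb x p : exists y, evalMX (R x) p = R y.
Proof.
elim/poly_ind: p => [|p c [y IHp]]; first by exists 0; rewrite !linear0.
exists (m (R y) x + m y (R x) + c *: x).
by rewrite evalMX_horner IHp rb_mul -linearZ -linearD.
Qed.

Lemma rb_exists_idem x : R x != 0 -> exists2 z, R z != 0 & m (R z) (R z) = R z.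
Proof.
move=> Rx_neq0; have [r rP] := evalMX_has_unit Rx_neq0.
have [z rz] := evalMX_rb x r; exists z; rewrite -rz ?rP //.
by apply: contraNneq Rx_neq0 => r0; rewrite -[R x](evalMX1 m) -rP r0 linear0l.
Qed.

Lemma rb_jordan_ker x z : R x = 0 -> R (jordan (R z) x) = 0.
Proof.
move=> Rx0; have := rb_mul z x; have := rb_mul x z; rewrite Rx0.
by rewrite !linear0l !linear0r addr0 add0r linearD => <- <-; rewrite addr0.
Qed.

Lemma rb_iter_peirce_half x z k : R (peirce_half (R z) x) = 0 ->
  R (iter k.+1 (peirce_half (R z)) x) = 0.
Proof.
move=> Sx; elim: k => [|k IHk] //.
by rewrite iterS linearB /= IHk subr0 rb_jordan_ker.
Qed.

Lemma rb_iter_jordan x z k : R (peirce_half (R z) x) = 0 ->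
  R (iter k (jordan (R z)) x) = R x /\
  R (peirce_half (R z) (iter k (jordan (R z)) x)) = 0.
Proof.
move=> Sx; elim: k => [|k [IHR IHS]] //=.
rewrite jordanE; split; first by rewrite linearD /= IHS addr0.
rewrite (linearD (peirce_half _)) linearD /= IHS add0r.
exact: (@rb_iter_peirce_half _ z 1).
Qed.

Lemma rb_idem_peirce_half z :
  m (R z) (R z) = R z -> R (peirce_half (R z) z) = 0.
Proof. by move=> ee; rewrite linearB /= -rb_mul ee subrr. Qed.

Lemma rb_idem_looping z k n : m (R z) (R z) = R z ->
  looping (peirce_half (R z)) (iter k (jordan (R z)) z) n -> R z = 0.
Proof.
move=> ee; have [-> //|e_neq0] := eqVneq (R z) 0.
move=> /(inj_looping_periodic (peirce_half_inj e_neq0 ee)) [j loop].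
have [RT RST] := rb_iter_jordan k (rb_idem_peirce_half ee).
by rewrite -RT loop rb_iter_peirce_half.
Qed.

Lemma rb_idem_eq0 z : m (R z) (R z) = R z -> R z = 0.
Proof.
move=> ee; have looping0 := @rb_idem_looping z 0 _ ee.
have [two0|two_neq0] := eqVneq (2 : F) 0; last first.
  exact: (looping0 _ (peirce_half_looping_neq2 two_neq0 z ee)).
have char2 : 2 \in [pchar F] by rewrite inE /= two0.
apply/eqP/contraT => /eqP e_neq0.
have two_scalars (a : F) : a \in [:: 0; 1].
  apply: contraT; rewrite !inE negb_or => /andP [a_neq0 a_neq1]; case: e_neq0.
  exact: (looping0 _ (peirce_half_looping_scalar char2 z ee a_neq0 a_neq1)).
have [n loop] := sqr_looping (jordan (R z) (jordan (R z) z)) two_scalars.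
case: e_neq0; apply: (rb_idem_looping (k := 4) ee).
exact: (peirce_half_looping_sqr char2 ee loop).
Qed.

End RotaBaxter.
End AlgebraicDomain.
End PowerAssociative.

Theorem theorem2 (F : fieldType) (A : lmodType F) (m : A -> A -> A)
  (R : A -> A) :
  bilinear_prod m -> power_associative m -> algebraic_alg m ->
  no_zero_divisors m -> rota_baxter m 0 R ->
  forall x : A, R x = 0.
Proof.
move=> [linl linr] m_pa m_alg m_dom R_rb x.
pose mB : {bilinear A -> A -> A} :=
  HB.pack m (bilinear_isBilinear.Build F A A A *:%R *:%R m
    (fun z a x y => linl a x y z, fun z a x y => linr a x y z)).
pose RL : {linear A -> A} :=
  HB.pack R (GRing.isLinear.Build F A A *:%R R R_rb.1).
apply/eqP/contraT => Rx_neq0.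
have [z /eqP e_neq0 ee] :=
  @rb_exists_idem F A mB m_pa m_alg m_dom RL R_rb x Rx_neq0.
by case: e_neq0; apply: (@rb_idem_eq0 F A mB m_pa m_alg m_dom RL R_rb z ee).
Qed.
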